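(* Let $c(t)$ be a continuous complex-valued function of $t\ge 0$, let $b(t):=\exp\left(\int_0^t c(\tau)\,d\tau\right)$, and consider the equation $$\frac{d}{dt}\lambda+\lambda^2=c(t)\lambda$$ along a particle path, with initial value $\lambda(0)\in\mathbb{C}$. (1) If $\operatorname{Im}(\lambda(0)b(t))\ne 0$ (for all $t$), then the solution $\lambda(t)$ remains regular for all time $t\ge0$. (2) If $\operatorname{Im}(\lambda(0)b(t))=0$ (for all $t$), then the solution remains bounded as long as $$\operatorname{Re}\left(\lambda(0)\int_0^t b(\tau)\,d\tau\right)>-1 .$$
   Context: The equation arises from $\partial_t u+u\cdot\nabla u=Cu$, $x\in\mathbb{R}^n$, with $C$ a constant matrix. An eigenvalue $\lambda$ of $\nabla u$ satisfies $\partial_t\lambda+u\cdot\nabla\lambda+\lambda^2=c\lambda$ with $c=lCr$, where $l,r$ are the normalized left and right eigenvectors of $\nabla u$ for $\lambda$. Along a particle path $x(\alpha,t)$, $\frac{dx}{dt}=u(x,t)$, $x(\alpha,0)=\alpha$, this becomes the ODE in the claim, with $\frac{d}{dt}=\partial_t+u\cdot\nabla$. ''Regular'' means that the solution of the ODE does not blow up in finite time. *)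

(* Defs.v *)
From Stdlib Require Import Reals.
From Coquelicot Require Import Coquelicot.
Open Scope R_scope.

Definition Cexp (z : C) : C := (exp (Re z) * cos (Im z), exp (Re z) * sin (Im z)).

Definition CInt (f : R -> C) (a b : R) : C :=
  RInt (V := C_R_CompleteNormedModule) f a b.

(* [is_derive] with the neighbourhoods of [t] restricted to [J]: it is the
   one-sided derivative at an endpoint of the interval [J]. *)
Definition is_derive_within (J : R -> Prop) (f : R -> C) (t : R) (d : C) : Prop :=
  filterdiff (K := R_AbsRing) (U := R_NormedModule) (V := C_R_NormedModule)
    f (within J (locally t)) (fun h : R => scal (V := C_R_NormedModule) h d).

Definition b (c : R -> C) (t : R) : C := Cexp (CInt c 0 t).

Definition is_solution (c : R -> C) (lambda0 : C) (J : R -> Prop)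
    (lambda : R -> C) : Prop :=
  lambda 0 = lambda0 /\
  forall t, J t -> exists d : C,
    is_derive_within J lambda t d /\
    (d + lambda t * lambda t = c t * lambda t)%C.

Definition bounded_on (J : R -> Prop) (f : R -> C) : Prop :=
  exists M : R, forall t, J t -> Cmod (f t) <= M.

(* [J] is meant to be a time interval starting at 0.  The solution lives on the
   whole of [J], and no solution given on [0, T) can blow up at a time T such
   that [0, T] is contained in [J]. *)
Definition no_blowup_on (c : R -> C) (lambda0 : C) (J : R -> Prop) : Prop :=
  (exists lambda, is_solution c lambda0 J lambda) /\
  (forall T : R, 0 < T -> (forall t, 0 <= t <= T -> J t) ->
   forall lambda, is_solution c lambda0 (fun t => 0 <= t < T) lambda ->
   bounded_on (fun t => 0 <= t < T) lambda).

Definition as_long_as (P : R -> Prop) (t : R) : Prop :=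
  0 <= t /\ forall s, 0 <= s <= t -> P s.

(* Main.v *)
Require Import Defs.
From Stdlib Require Import Reals Lra.
From Coquelicot Require Import Coquelicot.
Open Scope R_scope.

(** The substitution [lambda = lambda0 b / D], with
    [D t = 1 + lambda0 * int_0^t b], linearises the Riccati equation, so
    [lambda0 b / D] is a solution wherever [D] does not vanish.  It is the only
    one: for a solution [lambda], the defect [w = lambda D - lambda0 b] satisfies
    the linear equation [w' = (c - lambda) w] with [w 0 = 0].  Hence a solution
    can only blow up at a zero of [D].  If [Im (lambda0 b)] never vanishes, then
    [Im D], whose derivative it is, cannot return to its initial value [0]; in
    the second case [Re D > 0] is the hypothesis. *)

Notation is_derive_C := (is_derive (K := R_AbsRing) (V := C_R_NormedModule)).
Notation continuous_C := (continuous (T := R_UniformSpace) (U := C_UniformSpace)).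

(** * Calculus of complex-valued functions of a real variable *)

(** Expands [z] over the real basis [(1, 0)], [(0, 1)], so that a complex-valued function is rebuilt
    from two real ones multiplied by fixed vectors. *)
Lemma C_decomp (z : C) :
  plus (scal (V := C_R_NormedModule) (Re z) (1, 0))
       (scal (V := C_R_NormedModule) (Im z) (0, 1)) = z.
Proof.
  destruct z as [x y].
  apply injective_projections; simpl; unfold plus, scal, mult; simpl;
    unfold mult; simpl; ring.
Qed.

(** The projections are linear, which gives one direction by the chain rule; the basis expansion
    gives the other. Products, inverses and exponentials are then differentiated through their real
    coordinates. *)
Lemma is_derive_C_iff (f : R -> C) (t : R) (d : C) :
  is_derive_C f t d <->
  is_derive (fun s => Re (f s)) t (Re d) /\ is_derive (fun s => Im (f s)) t (Im d).
Proof.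
  split.
  - intros H; split; unfold is_derive.
    + apply (filterdiff_comp' (V := C_R_NormedModule) (W := R_NormedModule) f Re t
               (fun h => scal (V := C_R_NormedModule) h d) Re H).
      apply filterdiff_linear, is_linear_fst.
    + apply (filterdiff_comp' (V := C_R_NormedModule) (W := R_NormedModule) f Im t
               (fun h => scal (V := C_R_NormedModule) h d) Im H).
      apply filterdiff_linear, is_linear_snd.
  - intros [Hr Hi].
    rewrite <- (C_decomp d).
    apply (is_derive_ext (V := C_R_NormedModule)
      (fun s => plus (scal (V := C_R_NormedModule) (Re (f s)) (1, 0))
                     (scal (V := C_R_NormedModule) (Im (f s)) (0, 1)))).
    { intros s; apply C_decomp. }
    apply (is_derive_plus (V := C_R_NormedModule)).
    + apply (is_derive_scal_l (V := C_R_NormedModule) (fun s => Re (f s))), Hr.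
    + apply (is_derive_scal_l (V := C_R_NormedModule) (fun s => Im (f s))), Hi.
Qed.

Lemma continuous_C_iff (f : R -> C) (t : R) :
  continuous_C f t <->
  continuous (fun s => Re (f s)) t /\ continuous (fun s => Im (f s)) t.
Proof.
  split.
  - intros H; split.
    + apply (continuous_comp (U := R_UniformSpace) (V := C_UniformSpace) f Re t H).
      apply (continuous_fst (U := R_UniformSpace) (V := R_UniformSpace)).
    + apply (continuous_comp (U := R_UniformSpace) (V := C_UniformSpace) f Im t H).
      apply (continuous_snd (U := R_UniformSpace) (V := R_UniformSpace)).
  - intros [Hr Hi].
    apply (continuous_ext (T := R_UniformSpace) (U := C_UniformSpace)
      (fun s => plus (scal (V := C_R_NormedModule) (Re (f s)) (1, 0))
                     (scal (V := C_R_NormedModule) (Im (f s)) (0, 1)))).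
    { intros s; apply C_decomp. }
    apply (continuous_plus (K := R_AbsRing) (V := C_R_NormedModule));
      apply (continuous_scal_l (K := R_AbsRing) (V := C_R_NormedModule)); assumption.
Qed.

Lemma is_derive_C_continuous (f : R -> C) (t : R) (d : C) :
  is_derive_C f t d -> continuous_C f t.
Proof.
  intros H.
  apply (ex_derive_continuous (K := R_AbsRing) (V := C_R_NormedModule) f).
  now exists d.
Qed.

Lemma continuous_C_minus (f g : R -> C) (t : R) :
  continuous_C f t -> continuous_C g t -> continuous_C (fun s => (f s - g s)%C) t.
Proof.
  intros Hf Hg.
  exact (continuous_minus (K := R_AbsRing) (V := C_R_NormedModule) f g t Hf Hg).
Qed.

Lemma continuous_C_mult (f g : R -> C) (t : R) :
  continuous_C f t -> continuous_C g t -> continuous_C (fun s => (f s * g s)%C) t.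
Proof.
  intros Hf Hg.
  apply continuous_C_iff in Hf as [Hfr Hfi].
  apply continuous_C_iff in Hg as [Hgr Hgi].
  apply continuous_C_iff; split.
  - apply (continuous_minus (K := R_AbsRing) (V := R_NormedModule)
             (fun s => Re (f s) * Re (g s)) (fun s => Im (f s) * Im (g s)));
      apply (continuous_mult (K := R_AbsRing)); assumption.
  - apply (continuous_plus (K := R_AbsRing) (V := R_NormedModule)
             (fun s => Re (f s) * Im (g s)) (fun s => Im (f s) * Re (g s)));
      apply (continuous_mult (K := R_AbsRing)); assumption.
Qed.

Lemma is_derive_C_const (z : C) (t : R) : is_derive_C (fun _ => z) t (RtoC 0).
Proof. exact (is_derive_const (K := R_AbsRing) (V := C_R_NormedModule) z t). Qed.

Lemma is_derive_C_plus (f g : R -> C) (t : R) (df dg : C) :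
  is_derive_C f t df -> is_derive_C g t dg ->
  is_derive_C (fun s => (f s + g s)%C) t (df + dg)%C.
Proof.
  exact (is_derive_plus (K := R_AbsRing) (V := C_R_NormedModule) f g t df dg).
Qed.

Lemma is_derive_C_minus (f g : R -> C) (t : R) (df dg : C) :
  is_derive_C f t df -> is_derive_C g t dg ->
  is_derive_C (fun s => (f s - g s)%C) t (df - dg)%C.
Proof.
  exact (is_derive_minus (K := R_AbsRing) (V := C_R_NormedModule) f g t df dg).
Qed.

Lemma is_derive_C_mult (f g : R -> C) (t : R) (df dg : C) :
  is_derive_C f t df -> is_derive_C g t dg ->
  is_derive_C (fun s => (f s * g s)%C) t (df * g t + f t * dg)%C.
Proof.
  intros Hf Hg.
  apply is_derive_C_iff in Hf as [Hfr Hfi].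
  apply is_derive_C_iff in Hg as [Hgr Hgi].
  assert (Hprod : forall (u v : R -> R) (du dv : R),
    is_derive u t du -> is_derive v t dv ->
    is_derive (fun s => u s * v s) t (du * v t + u t * dv)).
  { intros u v du dv Hu Hv.
    exact (is_derive_mult u v t du dv Hu Hv Rmult_comm). }
  apply is_derive_C_iff; split.
  - replace (Re (df * g t + f t * dg)%C) with
      (minus (Re df * Re (g t) + Re (f t) * Re dg)
             (Im df * Im (g t) + Im (f t) * Im dg))
      by (unfold minus, plus, opp; simpl; unfold Re, Im; ring).
    apply (is_derive_minus (V := R_NormedModule)
             (fun s => Re (f s) * Re (g s)) (fun s => Im (f s) * Im (g s)));
      now apply Hprod.
  - replace (Im (df * g t + f t * dg)%C) with
      (plus (Re df * Im (g t) + Re (f t) * Im dg)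
            (Im df * Re (g t) + Im (f t) * Re dg))
      by (unfold plus; simpl; unfold Re, Im; ring).
    apply (is_derive_plus (V := R_NormedModule)
             (fun s => Re (f s) * Im (g s)) (fun s => Im (f s) * Re (g s)));
      now apply Hprod.
Qed.

Lemma C_sqr_sum_neq_0 (z : C) : z <> 0%C -> fst z * fst z + snd z * snd z <> 0.
Proof.
  intros Hz H; apply Hz.
  apply injective_projections; simpl; nra.
Qed.

Lemma is_derive_C_inv (f : R -> C) (t : R) (df : C) :
  is_derive_C f t df -> f t <> 0%C ->
  is_derive_C (fun s => (/ f s)%C) t (- df / (f t * f t))%C.
Proof.
  intros Hf H0.
  apply C_sqr_sum_neq_0 in H0.
  apply is_derive_C_iff in Hf as [Hfr Hfi].
  (* The coordinates are abstracted into real functions [u] and [v], which [auto_derive] can treat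
     as opaque. *)
  assert (H : forall (u v : R -> R) (p q : R),
    is_derive u t p -> is_derive v t q -> u t * u t + v t * v t <> 0 ->
    is_derive (fun s => Re (/ (u s, v s))%C) t
      (Re (- (p, q) / ((u t, v t) * (u t, v t)))%C) /\
    is_derive (fun s => Im (/ (u s, v s))%C) t
      (Im (- (p, q) / ((u t, v t) * (u t, v t)))%C)).
  { intros u v p q Hu Hv Huv; unfold Re, Im; simpl.
    split; auto_derive.
    1, 3: repeat split; try (eexists; eassumption); simpl; intros E; apply Huv; lra.
    all: rewrite (is_derive_unique (fun x : R => u x) t p Hu),
      (is_derive_unique (fun x : R => v x) t q Hv).
    all: field; split; nra. }
  apply is_derive_C_iff.
  specialize (H _ _ _ _ Hfr Hfi H0).
  now rewrite <- !surjective_pairing in H.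
Qed.

Lemma is_derive_C_Cexp (f : R -> C) (t : R) (df : C) :
  is_derive_C f t df -> is_derive_C (fun s => Cexp (f s)) t (df * Cexp (f t))%C.
Proof.
  intros Hf.
  apply is_derive_C_iff in Hf as [Hfr Hfi].
  assert (H : forall (u v : R -> R) (p q : R),
    is_derive u t p -> is_derive v t q ->
    is_derive (fun s => exp (u s) * cos (v s)) t
      (p * (exp (u t) * cos (v t)) - q * (exp (u t) * sin (v t))) /\
    is_derive (fun s => exp (u s) * sin (v s)) t
      (p * (exp (u t) * sin (v t)) + q * (exp (u t) * cos (v t)))).
  { intros u v p q Hu Hv.
    split; auto_derive.
    1, 3: repeat split; eexists; eassumption.
    all: rewrite (is_derive_unique (fun x : R => u x) t p Hu),
      (is_derive_unique (fun x : R => v x) t q Hv); ring. }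
  apply is_derive_C_iff.
  exact (H _ _ _ _ Hfr Hfi).
Qed.

Lemma Cexp_0 : Cexp 0%C = 1%C.
Proof. unfold Cexp; simpl; now rewrite exp_0, cos_0, sin_0, !Rmult_1_l. Qed.

(** The real exponential is positive, and cosine and sine have no common zero. *)
Lemma Cexp_neq_0 (z : C) : Cexp z <> 0%C.
Proof.
  intros H; injection H as Hc Hs.
  pose proof (exp_pos (Re z)) as He.
  pose proof (sin2_cos2 (Im z)) as Hsc; unfold Rsqr in Hsc.
  apply Rmult_integral in Hc; apply Rmult_integral in Hs.
  destruct Hc as [Hc|Hc], Hs as [Hs|Hs]; try lra.
  rewrite Hc, Hs in Hsc; lra.
Qed.

Lemma CInt_point (f : R -> C) (a : R) : CInt f a a = 0%C.
Proof. exact (RInt_point (V := C_R_CompleteNormedModule) a f). Qed.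

Lemma is_derive_C_CInt (f : R -> C) (a t : R) :
  (forall s, continuous_C f s) -> is_derive_C (fun s => CInt f a s) t (f t).
Proof.
  intros Hf.
  apply (is_derive_RInt (V := C_R_NormedModule) f (fun s => CInt f a s) a t).
  - apply filter_forall; intros s.
    apply (RInt_correct (V := C_R_CompleteNormedModule)).
    apply (ex_RInt_continuous (V := C_R_CompleteNormedModule)).
    intros z _; apply Hf.
  - apply Hf.
Qed.

Lemma b_0 (c : R -> C) : b c 0 = 1%C.
Proof. unfold b; rewrite CInt_point; apply Cexp_0. Qed.

Lemma is_derive_C_b (c : R -> C) (t : R) :
  (forall s, continuous_C c s) -> is_derive_C (b c) t (c t * b c t)%C.
Proof.
  intros Hc; unfold b.
  apply (is_derive_C_Cexp (fun s => CInt c 0 s)).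
  now apply is_derive_C_CInt.
Qed.

(** The mean value theorem holds only for real functions, so it is applied to each coordinate. The
    derivative is asked only inside the interval because the function this is used for has corners
    at [0] and [s]. *)
Lemma is_derive_C_0_const (f : R -> C) (s : R) :
  0 <= s ->
  (forall t, 0 < t < s -> is_derive_C f t (RtoC 0)) ->
  (forall t, continuous_C f t) -> f s = f 0.
Proof.
  intros Hs Hd Hf.
  assert (Hreal : forall g : R -> R,
    (forall t, 0 < t < s -> is_derive g t 0) ->
    (forall t, continuous g t) -> g s = g 0).
  { intros g Hg Hgc.
    destruct (MVT_gen g 0 s (fun _ => 0)) as [x [_ Hx]].
    - rewrite Rmin_left, Rmax_right by lra; exact Hg.
    - intros x _; apply continuity_pt_filterlim, Hgc.
    - lra. }
  apply injective_projections.
  - apply (Hreal (fun t => Re (f t))).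
    + intros t Ht; apply (proj1 (is_derive_C_iff f t 0%C)), Hd, Ht.
    + intros t; apply (proj1 (continuous_C_iff f t)), Hf.
  - apply (Hreal (fun t => Im (f t))).
    + intros t Ht; apply (proj1 (is_derive_C_iff f t 0%C)), Hd, Ht.
    + intros t; apply (proj1 (continuous_C_iff f t)), Hf.
Qed.

Lemma bounded_on_segment (f : R -> C) (T : R) :
  0 <= T -> (forall t, 0 <= t <= T -> continuous_C f t) ->
  bounded_on (fun t => 0 <= t <= T) f.
Proof.
  intros HT Hf.
  destruct (continuity_ab_maj (fun t => Cmod (f t)) 0 T HT) as [x [Hx _]].
  - intros t Ht; apply continuity_pt_filterlim.
    eapply filterlim_comp; [apply Hf, Ht|].
    apply (filterlim_norm (K := C_AbsRing) (V := C_NormedModule)).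
  - now exists (Cmod (f x)).
Qed.

(** * Derivatives and continuity relative to a set *)

Lemma is_derive_C_within (J : R -> Prop) (f : R -> C) (t : R) (d : C) :
  J t -> is_derive_C f t d -> is_derive_within J f t d.
Proof.
  intros HJ [Hl Hf]; split; [exact Hl|].
  intros x Hx.
  (* The restricted filter can converge only to [t]: were [x] another limit, the points different
     from [t] would form a neighbourhood of [x], yet [t] itself lies in [J]. *)
  assert (x = t) as ->.
  { destruct (Req_dec x t) as [E|E]; [exact E|exfalso].
    specialize (Hx (fun y => y <> t) (open_neq t x E)).
    exact (locally_singleton t _ Hx HJ eq_refl). }
  intros eps.
  generalize (Hf t (fun P HP => HP) eps).
  apply filter_le_within.
Qed.

Lemma is_derive_within_C (J : R -> Prop) (f : R -> C) (t : R) (d : C) :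
  locally t J -> is_derive_within J f t d -> is_derive_C f t d.
Proof.
  intros HJ [Hl Hf]; split; [exact Hl|].
  intros x Hx eps.
  rewrite <- (is_filter_lim_locally_unique t x Hx) in *.
  specialize (Hf t (filter_le_within J) eps).
  generalize (filter_and _ _ HJ Hf).
  apply filter_imp; intros y [Hy H]; exact (H Hy).
Qed.

Lemma is_derive_within_filterlim (J : R -> Prop) (f : R -> C) (t : R) (d : C) :
  is_derive_within J f t d ->
  filterlim f (within J (locally t)) (locally (T := C_UniformSpace) (f t)).
Proof.
  intros H.
  apply (filterdiff_continuous_aux (K := R_AbsRing) (U := R_NormedModule)
    (V := C_R_NormedModule) (F := within J (locally t)) f).
  - now eexists; apply H.
  - apply filter_le_within.
Qed.

(** Since [r] takes all its values in [J], relative continuity of [f] suffices for the composite;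
    this extends a function on an interval continuously to the whole line. *)
Lemma continuous_on_retract (J : R -> Prop) (r : R -> R) (f : R -> C) :
  continuous_on (U := C_UniformSpace) J f ->
  (forall t, J (r t)) -> (forall t, continuous r t) ->
  forall t, continuous_C (fun s => f (r s)) t.
Proof.
  intros Hf HJ Hr t.
  apply (filterlim_comp _ _ _ r f _ (within J (locally (r t))));
    [|now apply Hf, HJ].
  intros P HP.
  unfold filtermap.
  apply (filter_imp (F := locally t) (fun s => J (r s) -> P (r s))).
  - intros s Hs; exact (Hs (HJ s)).
  - exact (Hr t _ HP).
Qed.

Lemma continuous_Rmax_l (a t : R) : continuous (fun s => Rmax a s) t.
Proof.
  apply (continuous_ext (fun s => (a + s + Rabs (a - s)) / 2)).
  { intros s; unfold Rmax, Rabs.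
    destruct (Rle_dec a s), (Rcase_abs (a - s)); lra. }
  apply continuity_pt_filterlim; reg.
Qed.

Lemma continuous_Rmin_l (a t : R) : continuous (fun s => Rmin a s) t.
Proof.
  apply (continuous_ext (fun s => (a + s - Rabs (a - s)) / 2)).
  { intros s; unfold Rmin, Rabs.
    destruct (Rle_dec a s), (Rcase_abs (a - s)); lra. }
  apply continuity_pt_filterlim; reg.
Qed.

(** * The Riccati equation *)

(** Its logarithmic derivative is the Riccati solution, since its derivative is
    [lambda0 * b c t]. *)
Definition riccati_denom (c : R -> C) (lambda0 : C) (t : R) : C :=
  (1 + lambda0 * CInt (b c) 0 t)%C.

Lemma riccati_denom_0 (c : R -> C) (lambda0 : C) : riccati_denom c lambda0 0 = 1%C.
Proof. unfold riccati_denom; rewrite CInt_point; ring. Qed.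

Definition riccati_sol (c : R -> C) (lambda0 : C) (t : R) : C :=
  (lambda0 * b c t * / riccati_denom c lambda0 t)%C.

Section GlobalCoefficient.

Variables (c : R -> C) (lambda0 : C).
(** Continuity on the whole line makes the derivatives of [b c] and [D] two-sided even at time
    [0]. *)
Hypothesis Hc : forall t, continuous_C c t.

Let D := riccati_denom c lambda0.

Lemma is_derive_lambda0_b (t : R) :
  is_derive_C (fun s => (lambda0 * b c s)%C) t (c t * (lambda0 * b c t))%C.
Proof.
  replace (c t * (lambda0 * b c t))%C
    with (0 * b c t + lambda0 * (c t * b c t))%C by ring.
  apply (is_derive_C_mult (fun _ => lambda0)).
  - apply is_derive_C_const.
  - now apply is_derive_C_b.
Qed.

Lemma is_derive_riccati_denom (t : R) : is_derive_C D t (lambda0 * b c t)%C.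
Proof.
  replace (lambda0 * b c t)%C
    with (0 + (0 * CInt (b c) 0 t + lambda0 * b c t))%C by ring.
  apply (is_derive_C_plus (fun _ => 1%C) (fun s => (lambda0 * CInt (b c) 0 s)%C)).
  - apply is_derive_C_const.
  - apply (is_derive_C_mult (fun _ => lambda0)).
    + apply is_derive_C_const.
    + apply is_derive_C_CInt; intros s.
      eapply is_derive_C_continuous, is_derive_C_b, Hc.
Qed.

Lemma is_derive_riccati_sol (t : R) :
  D t <> 0%C ->
  is_derive_C (riccati_sol c lambda0) t
    (c t * riccati_sol c lambda0 t
     - riccati_sol c lambda0 t * riccati_sol c lambda0 t)%C.
Proof.
  intros HD.
  unfold riccati_sol.
  replace (c t * _ - _)%C with
    (c t * (lambda0 * b c t) * / D t
     + lambda0 * b c t * (- (lambda0 * b c t) / (D t * D t)))%C.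
  - apply (is_derive_C_mult (fun s => (lambda0 * b c s)%C)).
    + apply is_derive_lambda0_b.
    + now apply is_derive_C_inv; [apply is_derive_riccati_denom|].
  - unfold D in *; field; exact HD.
Qed.

(** The defect times its integrating factor has zero derivative and starts at [0]. The product form
    avoids dividing by [D]. *)
Lemma riccati_sol_unique (T : R) (lambda : R -> C) :
  is_solution c lambda0 (fun t => 0 <= t < T) lambda ->
  forall s, 0 <= s < T -> (lambda s * D s = lambda0 * b c s)%C.
Proof.
  intros [H0 Hd] s Hs.
  (* Clamping time to [[0, s]], which lies inside [[0, T)], replaces [lambda] by a function [l]
     continuous on all of [R], so that the integral inside [b a] can be differentiated
     everywhere. *)
  set (r := fun t => Rmax 0 (Rmin s t)).
  assert (Hr : forall t, 0 <= t <= s -> r t = t).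
  { intros t Ht; unfold r; rewrite Rmin_right, Rmax_right by lra; reflexivity. }
  assert (Hrc : forall t, continuous r t).
  { intros t; apply (continuous_comp (Rmin s) (Rmax 0)).
    - apply continuous_Rmin_l.
    - apply continuous_Rmax_l. }
  set (l := fun t => lambda (r t)).
  assert (Hlc : forall t, continuous_C l t).
  { apply (continuous_on_retract (fun t => 0 <= t < T) r lambda); [| |exact Hrc].
    - intros t Ht; destruct (Hd t Ht) as [d [Hdt _]].
      now apply is_derive_within_filterlim with d.
    - intros t; unfold r.
      pose proof (Rmax_l 0 (Rmin s t)).
      pose proof (Rmin_l s t).
      split; [assumption|apply Rmax_lub_lt; lra]. }
  assert (Hld : forall t, 0 < t < s ->
    is_derive_C l t (c t * l t - l t * l t)%C).
  { intros t Ht.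
    destruct (Hd t) as [d [Hdt E]]; [lra|].
    assert (Hl : l t = lambda t) by (unfold l; rewrite Hr by lra; reflexivity).
    replace (c t * l t - l t * l t)%C with d by (rewrite Hl, <- E; ring).
    apply (is_derive_ext_loc (V := C_R_NormedModule) lambda).
    - apply (locally_interval _ t 0 s); simpl; try lra.
      intros y Hy0 Hys; unfold l; rewrite Hr by lra; reflexivity.
    - apply (is_derive_within_C (fun t => 0 <= t < T)); [|exact Hdt].
      apply (locally_interval _ t 0 s); simpl; intros; lra. }
  set (a := fun t => (l t - c t)%C).
  assert (Hac : forall t, continuous_C a t).
  { intros t; now apply continuous_C_minus. }
  (* [b a] is the integrating factor of [w' = (c - lambda) w]. *)
  set (w := fun t => (l t * D t - lambda0 * b c t)%C).
  assert (Hw : (w s * b a s = w 0 * b a 0)%C).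
  { apply (is_derive_C_0_const (fun t => (w t * b a t)%C)); [lra| |].
    - intros t Ht.
      (* The derivative of [w] equals [(c t - l t) * w t], which cancels the contribution
         [w t * a t] of the integrating factor. *)
      replace (RtoC 0) with
        (((c t * l t - l t * l t) * D t + l t * (lambda0 * b c t)
          - c t * (lambda0 * b c t)) * b a t + w t * (a t * b a t))%C
        by (unfold w, a; ring).
      apply (is_derive_C_mult w).
      + apply (is_derive_C_minus (fun t => (l t * D t)%C)).
        * apply is_derive_C_mult; [now apply Hld|apply is_derive_riccati_denom].
        * apply is_derive_lambda0_b.
      + now apply is_derive_C_b.
    - intros t; apply continuous_C_mult.
      + apply continuous_C_minus.
        * apply continuous_C_mult; [apply Hlc|].
          eapply is_derive_C_continuous, is_derive_riccati_denom.
        * eapply is_derive_C_continuous, is_derive_lambda0_b.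
      + now eapply is_derive_C_continuous, is_derive_C_b. }
  assert (Hl0 : l 0 = lambda0) by (unfold l; rewrite Hr by lra; exact H0).
  assert (Hls : l s = lambda s) by (unfold l; rewrite Hr by lra; reflexivity).
  assert (Hw0 : w 0 = 0%C).
  { unfold w, D; rewrite riccati_denom_0, b_0, Hl0; ring. }
  assert (Hws : w s = 0%C).
  { destruct (Ceq_dec (w s) 0%C) as [E|E]; [exact E|exfalso].
    rewrite Hw0, Cmult_0_l in Hw.
    exact (Cmult_neq_0 _ _ E (Cexp_neq_0 _) Hw). }
  unfold w in Hws; rewrite Hls in Hws.
  replace (lambda s * D s)%C
    with (lambda s * D s - lambda0 * b c s + lambda0 * b c s)%C by ring.
  rewrite Hws; ring.
Qed.

(** The explicit quotient gives existence. It is continuous on the compact segment [[0, T]],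
    including the endpoint [T], hence bounded there, and any solution on [[0, T)] coincides with
    it. *)
Lemma no_blowup_on_denom_neq_0 (J : R -> Prop) :
  (forall t, J t -> D t <> 0%C) -> no_blowup_on c lambda0 J.
Proof.
  intros HD; split.
  - exists (riccati_sol c lambda0); split.
    + unfold riccati_sol; rewrite riccati_denom_0, b_0; field.
    + intros t Ht.
      exists (c t * riccati_sol c lambda0 t
        - riccati_sol c lambda0 t * riccati_sol c lambda0 t)%C.
      split; [|ring].
      apply is_derive_C_within; [exact Ht|].
      now apply is_derive_riccati_sol, HD.
  - intros T HT HJ lambda Hsol.
    destruct (bounded_on_segment (riccati_sol c lambda0) T) as [M HM]; [lra| |].
    + intros t Ht.
      now eapply is_derive_C_continuous, is_derive_riccati_sol, HD, HJ.
    + exists M; intros t Ht.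
      replace (lambda t) with (riccati_sol c lambda0 t); [apply HM; lra|].
      unfold riccati_sol.
      rewrite <- (riccati_sol_unique T lambda Hsol t Ht).
      unfold D; field.
      apply HD, HJ; lra.
Qed.

Lemma denom_neq_0_of_Im (t : R) :
  0 <= t -> (forall s, 0 <= s -> Im (lambda0 * b c s)%C <> 0) -> D t <> 0%C.
Proof.
  intros Ht Him E.
  assert (HdIm : forall s, is_derive (fun x => Im (D x)) s (Im (lambda0 * b c s)%C)).
  { intros s; apply (proj1 (is_derive_C_iff D s _)), is_derive_riccati_denom. }
  assert (HD0 : D 0 = 1%C) by apply riccati_denom_0.
  (* [Im (D x)] vanishes at [0] and, if [D t] is zero, also at [t]; Rolle's argument then yields a
     forbidden zero of its derivative unless [t = 0]. *)
  destruct (MVT_gen (fun x => Im (D x)) 0 t (fun s => Im (lambda0 * b c s)%C))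
    as [x [Hx H]].
  - intros s _; apply HdIm.
  - intros s _; apply continuity_pt_filterlim.
    apply (ex_derive_continuous (fun x => Im (D x))); eexists; apply HdIm.
  - rewrite Rmin_left, Rmax_right in Hx by lra.
    rewrite E, HD0 in H.
    replace (Im 0%C - Im 1%C) with 0 in H by (simpl; ring).
    symmetry in H; apply Rmult_integral in H as [H|H].
    + apply (Him x); [lra|exact H].
    (* In the degenerate case [t = 0] the denominator is [1]. *)
    + replace t with 0 in E by lra.
      rewrite HD0 in E; apply RtoC_inj in E; lra.
Qed.

End GlobalCoefficient.

(** * Dependence on the coefficient at nonnegative times only *)

Lemma CInt_ext_nonneg (f g : R -> C) (t : R) :
  (forall s, 0 <= s -> f s = g s) -> 0 <= t -> CInt f 0 t = CInt g 0 t.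
Proof.
  intros H Ht.
  apply (RInt_ext (V := C_R_CompleteNormedModule)).
  rewrite Rmin_left by lra; intros s Hs; apply H; lra.
Qed.

Lemma b_ext_nonneg (c1 c2 : R -> C) (t : R) :
  (forall s, 0 <= s -> c1 s = c2 s) -> 0 <= t -> b c1 t = b c2 t.
Proof. intros H Ht; unfold b; now rewrite (CInt_ext_nonneg c1 c2). Qed.

Lemma is_solution_ext (c1 c2 : R -> C) (lambda0 : C) (J : R -> Prop) (lambda : R -> C) :
  (forall t, J t -> c1 t = c2 t) ->
  is_solution c1 lambda0 J lambda -> is_solution c2 lambda0 J lambda.
Proof.
  intros H [H0 Hd]; split; [exact H0|].
  intros t Ht; rewrite <- H by exact Ht; now apply Hd.
Qed.

(** Both clauses evaluate the coefficient only at times in [J] or in [[0, T)], all nonnegative. *)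
Lemma no_blowup_on_ext (c1 c2 : R -> C) (lambda0 : C) (J : R -> Prop) :
  (forall t, J t -> 0 <= t) -> (forall t, 0 <= t -> c1 t = c2 t) ->
  no_blowup_on c1 lambda0 J -> no_blowup_on c2 lambda0 J.
Proof.
  intros HJ H [[l Hl] Hb]; split.
  - exists l; apply (is_solution_ext c1); auto.
  - intros T HT HTJ lambda Hsol.
    apply Hb; try assumption.
    apply (is_solution_ext c2); [|exact Hsol].
    intros t Ht; symmetry; apply H; lra.
Qed.

Theorem lemma4p1 (c : R -> C) (lambda0 : C)
    (hc : continuous_on (fun t : R => 0 <= t) c) :
  ((forall t : R, 0 <= t -> Im (lambda0 * b c t)%C <> 0) ->
     no_blowup_on c lambda0 (fun t : R => 0 <= t)) /\
  ((forall t : R, 0 <= t -> Im (lambda0 * b c t)%C = 0) ->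
     no_blowup_on c lambda0
       (as_long_as (fun t : R => Re (lambda0 * CInt (b c) 0 t)%C > -1))).
Proof.
  (* Freezing [c] at its value [c 0] for negative times turns one-sided continuity at [0] into
     continuity on [R]. *)
  set (c' := fun t => c (Rmax 0 t)).
  assert (Hc' : forall t, continuous_C c' t).
  { apply (continuous_on_retract (fun t => 0 <= t) (Rmax 0) c); [exact hc| |].
    - intros t; apply Rmax_l.
    - intros t; apply continuous_Rmax_l. }
  assert (Hcc : forall t, 0 <= t -> c' t = c t).
  { intros t Ht; unfold c'; now rewrite Rmax_right. }
  assert (Hb : forall t, 0 <= t -> b c' t = b c t).
  { intros t; now apply b_ext_nonneg. }
  split; intros Him.
  - apply (no_blowup_on_ext c'); [tauto|exact Hcc|].
    apply no_blowup_on_denom_neq_0; [exact Hc'|].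
    intros t Ht; apply denom_neq_0_of_Im; [exact Hc'|exact Ht|].
    intros s Hs; rewrite Hb by exact Hs; now apply Him.
  - apply (no_blowup_on_ext c'); [intros t Ht; apply Ht|exact Hcc|].
    apply no_blowup_on_denom_neq_0; [exact Hc'|].
    intros t [Ht HRe] E.
    (* The condition at the final time [s = t] already makes the real part of the denominator
       positive. *)
    specialize (HRe t (conj Ht (Rle_refl t))).
    rewrite <- (CInt_ext_nonneg (b c') (b c)) in HRe by assumption.
    apply (f_equal Re) in E; unfold riccati_denom in E.
    simpl in E, HRe; lra.
Qed.
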